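(* Let $\alpha>-1$, $1<p\le q<\infty$, and let $p'$ be the conjugate exponent of $p$. Assume that $\omega$ is a weight and $\mu$ a positive Borel measure on $\mathcal H$ such that for some $r>1$ there is a positive constant $C$ for which, for any interval $I\subset\mathbb R$, $$\left(\frac{1}{|Q_I|_\alpha}\int_{Q_I}\omega(z)^{-p'r}\,dV_\alpha(z)\right)^{\frac{q}{p'r}}\mu(Q_I)\le C|Q_I|_\alpha^{q/p}.$$ Then there is a positive constant $K$ such that for any $f\in L^p(\mathcal H,\omega\,dV_\alpha)$, $$\left(\int_{\mathcal H}\left(\mathcal{M}_\alpha f(z)\right)^q d\mu(z)\right)^{1/q}\le K\|f\omega\|_{p,\alpha}.$$
   Context: $\mathcal H=\{z=x+iy\in\mathbb C: x\in\mathbb R,\ y>0\}$ is the upper-half plane and $dV_\alpha(x+iy)=y^\alpha\,dx\,dy$. A weight is a nonnegative locally integrable function on $\mathcal H$. $L^p(\mathcal H,\omega\,dV_\alpha)$ is the set of functions $f$ on $\mathcal H$ with $\int_{\mathcal H}|f|^p\omega\,dV_\alpha<\infty$, and $\|g\|_{p,\alpha}=\left(\int_{\mathcal H}|g|^p dV_\alpha\right)^{1/p}$. Intervals $I\subset\mathbb R$ are bounded and of positive length $|I|$; the Carleson square of $I$ is $Q_I=\{x+iy: x\in I,\ 0<y<|I|\}$, and $|Q_I|_\alpha=\int_{Q_I}dV_\alpha$. Hardy-Littlewood maximal function: $\mathcal{M}_\alpha f(z)=\sup_{I\subset\mathbb R}\frac{\chi_{Q_I}(z)}{|Q_I|_\alpha}\int_{Q_I}|f|\,dV_\alpha$,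 the supremum over all intervals $I$. *)

(* Defs.v *)
From HB Require Import structures.
From mathcomp Require Import all_boot all_order all_algebra.
From mathcomp Require Import all_classical all_reals all_analysis.
From mathcomp Require Import complex.
Set Implicit Arguments.
Unset Strict Implicit.
Unset Printing Implicit Defensive.
Import Order.TTheory GRing.Theory Num.Theory.
Import numFieldNormedType.Exports.
Local Open Scope classical_set_scope.
Local Open Scope ring_scope.

(* MathComp-Analysis. Points x + iy of the plane are pairs (x, y) : R * R, with
   the product Borel sigma-algebra, product topology and area measure dx dy. *)

Definition upper_half_plane (R : realType) : set (R * R) := [set z | 0 < z.2].

(* R * R seen as a measurable type; [measurableTypeR R] is R with its Borel
   sets, in the form on which the library defines [lebesgue_measure]. *)
Notation plane R := (measurableTypeR R * measurableTypeR R)%type.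

Definition area (R : realType) : {measure set (plane R) -> \bar R} :=
  (@lebesgue_measure R \x @lebesgue_measure R)%E.

(* Lebesgue measurability, i.e., measurability for the completion of the area
   measure. [measurable_fun] alone is Borel measurability. All integrals below
   are of nonnegative functions, for which the library integral is a supremum
   over simple Borel functions lying below the integrand; for a Lebesgue
   measurable integrand it is thus the Lebesgue integral. *)
Definition Lebesgue_measurable_fun (R : realType) (D : set (R * R))
    (f : R * R -> R) : Prop :=
  exists2 g : plane R -> R, measurable_fun (D : set (plane R)) g &
    {ae area R, forall z, D z -> f z = g z}.

Definition Lebesgue_measurable_funC (R : realType) (D : set (R * R))
    (f : R * R -> R[i]) : Prop :=
  Lebesgue_measurable_fun D (fun z => complex.Re (f z)) /\
  Lebesgue_measurable_fun D (fun z => complex.Im (f z)).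

Definition weight (R : realType) (w : R * R -> R) : Prop :=
  [/\ Lebesgue_measurable_fun (@upper_half_plane R) w,
      forall z, upper_half_plane z -> 0 <= w z &
      forall K : set (R * R), K `<=` @upper_half_plane R -> compact K ->
        (\int[area R]_(z in K) (w z)%:E < +oo)%E].

(* The integral of g over D against dV_a = y ^ a dx dy. *)
Definition intV (R : realType) (a : R) (D : set (R * R))
    (g : R * R -> \bar R) : \bar R :=
  (\int[area R]_(z in D) (g z * (z.2 `^ a)%:E))%E.

Definition cabs (R : realType) (c : R[i]) : R := ComplexField.Normc.normc c.

Definition LpV (R : realType) (p a : R) (w : R * R -> R)
    (f : R * R -> R[i]) : Prop :=
  Lebesgue_measurable_funC (@upper_half_plane R) f /\
  (intV a (@upper_half_plane R) (fun z => (cabs (f z) `^ p * w z)%:E)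
     < +oo)%E.

Definition normV (R : realType) (p a : R) (g : R * R -> R[i]) : \bar R :=
  (intV a (@upper_half_plane R) (fun z => (cabs (g z) `^ p)%:E) `^ p^-1)%E.

Definition length (R : realType) (I : set R) : R := fine (lebesgue_measure I).

(* The endpoints may or may not belong to I. *)
Definition bounded_interval (R : realType) (I : set R) : Prop :=
  [/\ is_interval I, bounded_set I & 0 < length I].

Definition carleson_square (R : realType) (I : set R) : set (R * R) :=
  [set z | I z.1 /\ 0 < z.2 < length I].

Definition carleson_area (R : realType) (a : R) (I : set R) : \bar R :=
  intV a (carleson_square I) (fun=> 1%E).

Definition maximal (R : realType) (a : R) (f : R * R -> R[i]) (z : R * R) :
    \bar R :=
  ereal_sup [set ((\1_(carleson_square I) z)%:E / carleson_area a I *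
                  intV a (carleson_square I) (fun t => (cabs (f t))%:E))%E
            | I in @bounded_interval R].

(* w z ^ (- s) for s > 0, equal to +oo where w vanishes ([powR] would give 0
   there). *)
Definition neg_power (R : realType) (w : R * R -> R) (s : R) (z : R * R) :
    \bar R :=
  (((w z) `^ s)%:E^-1)%E.

(* Main.v *)
Require Import Defs.
From HB Require Import structures.
From mathcomp Require Import all_boot all_order all_algebra.
From mathcomp Require Import all_classical all_reals all_analysis.
From mathcomp Require Import complex.
From mathcomp Require Import measurable_realfun zify ring lra.
Set Implicit Arguments.
Unset Strict Implicit.
Unset Printing Implicit Defensive.
Import Order.TTheory GRing.Theory Num.Theory.
Import numFieldNormedType.Exports.
Local Open Scope classical_set_scope.
Local Open Scope ring_scope.

(** Cover each interval I by a grid interval J = [m 2^k, (m + 2) 2^k[ with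
    |J| <= 4 |I|. Then (M f)^q is at most a constant times the sum, over all
    grid intervals, of the indicator of Q_J times the q-th power of the
    alpha-average a_J of |f| over Q_J. Hoelder's inequality applied to
      |f| = (|f| w y^e) * w^-1 * y^-e,
    with exponents p, p' r and p' r' (r' conjugate to r), and the testing
    condition give
      a_J^q mu(Q_J) <= D (|J|^(-e p) int_{Q_J} (|f| w)^p y^(e p) dV)^(q/p).
    As q >= p, the sum of these over J is at most the (q/p)-th power of the sum
    without the exponent q/p, and that sum is bounded by int (|f| w)^p dV: at a
    point of height y, the terms (y / |J|)^(e p) with the point in Q_J are
    dominated by two geometric series. *)

(** * Integrals of nonnegative functions that need not be Borel, and weighted Hoelder *)

Section nonmeasurable_integrands.
Local Open Scope ereal_scope.
Context d (T : measurableType d) (R : realType).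
Variable mu : {measure set T -> \bar R}.

(** The integral of a nonnegative function is the supremum over the simple functions below it, and a
    larger integrand only enlarges that family. This covers the maximal function without any
    discussion of its measurability. *)
Lemma le_integral_ge0 (D : set T) (f g : T -> \bar R) :
  (forall x, D x -> 0 <= f x) -> (forall x, D x -> f x <= g x) ->
  \int[mu]_(x in D) f x <= \int[mu]_(x in D) g x.
Proof.
move=> f0 fg; have g0 x : D x -> 0 <= g x.
  by move=> Dx; exact: le_trans (f0 _ Dx) (fg _ Dx).
rewrite !ge0_integralE//; apply: ereal_sup_le => _ [h hf <-].
exists h => // x; apply: le_trans (hf x) _; exact: lee_restrict.
Qed.

(** Let N be a measurable null set outside which f = g. Then f is squeezed between two measurable
    functions, g set to 0 on N and g set to +oo on N, and both have the integral of g. *)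
Lemma ae_eq_integral_ge0 (D : set T) (f g : T -> \bar R) :
  measurable D -> measurable_fun D g ->
  (forall x, D x -> 0 <= f x) -> (forall x, D x -> 0 <= g x) ->
  {ae mu, forall x, D x -> f x = g x} ->
  \int[mu]_(x in D) f x = \int[mu]_(x in D) g x.
Proof.
move=> mD mg f0 g0 [N [mN N0 fgN]].
have fg x : D x -> ~ N x -> f x = g x.
  move=> Dx nN; apply: contrapT => fgx; apply/nN/fgN => /= h; exact/fgx/h.
have m1 : measurable_fun D (g \_ (~` N)).
  apply/(measurable_restrict g (measurableC mN) mD).
  by apply: (measurable_funS mD) mg; exact: subIsetl.
have m2 : measurable_fun D (fun x => if x \in N then +oo else g x).
  apply: measurable_fun_if => //.
    apply: (@measurable_fun_bool _ _ _ _ true).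
    rewrite (_ : _ @^-1` _ = N); first exact: measurableI.
    by apply/seteqP; split => x; [exact: set_mem|exact: mem_set].
  by apply: (measurable_funS mD) mg; exact: subIsetl.
apply/eqP; rewrite eq_le; apply/andP; split.
- rewrite [leRHS](_ : _ = \int[mu]_(x in D) (if x \in N then +oo else g x)).
    apply: le_integral_ge0 => // x Dx; case: ifPn; first by rewrite leey.
    by rewrite notin_setE => nN; rewrite fg.
  apply: ge0_ae_eq_integral => //.
    by move=> x Dx; case: ifP => // _; exact: g0.
  exists N; split => // x /= h; apply: contrapT => nN; apply: h => Dx.
  by rewrite memNset.
- rewrite [leLHS](_ : _ = \int[mu]_(x in D) (g \_ (~` N)) x).
    apply: le_integral_ge0 => // x Dx; rewrite patchE; case: ifPn => //.
    + by rewrite inE => nN; exact: g0.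
    + by rewrite inE => nN; rewrite fg.
    + by move=> _; exact: f0.
  apply: ge0_ae_eq_integral => //.
    by move=> x Dx; rewrite patchE; case: ifP => // _; exact: g0.
  exists N; split => // x /= h; apply: contrapT => nN; apply: h => Dx.
  by rewrite patchE mem_set.
Qed.

(** This is Hoelder's inequality for the measure with density h. It follows from the unweighted one
    applied to u h^(1/p) and v h^(1/q), whose product is u v h because the exponents are
    conjugate. *)
Lemma hoelder_weighted (D : set T) (u v h : T -> R) (p q : R) :
  measurable D -> measurable_fun D u -> measurable_fun D v ->
  measurable_fun D h ->
  (forall x, D x -> (0 <= u x)%R) -> (forall x, D x -> (0 <= v x)%R) ->
  (forall x, D x -> (0 <= h x)%R) ->
  (0 < p)%R -> (0 < q)%R -> (p^-1 + q^-1 = 1)%R ->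
  \int[mu]_(x in D) (u x * v x * h x)%:E <=
  (\int[mu]_(x in D) (u x `^ p * h x)%:E) `^ p^-1 *
  (\int[mu]_(x in D) (v x `^ q * h x)%:E) `^ q^-1.
Proof.
move=> mD mu_ mv mh u0 v0 h0 p0 q0 pq.
pose U x := (u x * h x `^ p^-1)%R; pose V x := (v x * h x `^ q^-1)%R.
have mpow s : measurable_fun D (fun x => h x `^ s)%R.
  exact: (@measurableT_comp _ _ _ _ _ _ (@powR R ^~ s)).
have mU : measurable_fun setT (U \_ D).
  by apply/(measurable_restrictT _ mD); apply: measurable_funM => //; exact: mpow.
have mV : measurable_fun setT (V \_ D).
  by apply/(measurable_restrictT _ mD); apply: measurable_funM => //; exact: mpow.
have := hoelder mu mU mV p0 q0 pq.
have aux (F : T -> R) (f : T -> R) s : (0 < s)%R ->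
    (forall x, D x -> (0 <= f x)%R) ->
    (forall x, D x -> F x = f x * h x `^ s^-1)%R ->
    \int[mu]_x (`|(F \_ D) x| `^ s)%:E = \int[mu]_(x in D) (f x `^ s * h x)%:E.
  move=> s0 f0 FE; rewrite [RHS]integral_mkcond; apply: eq_integral => x _.
  rewrite !patchE; case: ifPn => [|_]; last by rewrite normr0 powR0// gt_eqF.
  rewrite inE => Dx; rewrite FE// ger0_norm ?mulr_ge0 ?f0 ?powR_ge0//.
  rewrite powRM ?powR_ge0 ?f0// -powRrM mulVf ?gt_eqF// powRr1//; exact: h0.
rewrite [in X in _ <= X]unlock /=.
rewrite (aux U u p p0 u0 (fun _ _ => erefl)) (aux V v q q0 v0 (fun _ _ => erefl)).
rewrite Lnorm1; congr (_ <= _).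
rewrite [RHS]integral_mkcond; apply: eq_integral => x _.
rewrite /= !patchE; case: ifPn => [|_]; last by rewrite mulr0 normr0.
rewrite inE => Dx; rewrite ger0_norm; last first.
  by rewrite !mulr_ge0 ?powR_ge0 ?u0 ?v0.
congr EFin; rewrite /U /V mulrACA -powRD ?pq ?powRr1 ?h0//.
by apply/implyP; rewrite oner_eq0.
Qed.

End nonmeasurable_integrands.

(** * Integrals of powers over intervals *)

Lemma integral_powR_itvcc (R : realType) (b u v : R) : -1 < b -> 0 < u -> u < v ->
  (\int[lebesgue_measure]_(y in `[u, v]) (y `^ b)%:E =
   (v `^ (b + 1) / (b + 1))%:E - (u `^ (b + 1) / (b + 1))%:E)%E.
Proof.
move=> b1 u0 uv.
have b10 : b + 1 != 0 by rewrite gt_eqF// -ltrBlDr sub0r.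
pose F (y : R) := (b + 1)^-1 * y `^ (b + 1).
have dF (y : R) : 0 < y -> is_derive y 1 F (y `^ b).
  move=> y0; have := @is_derive1_powR R (b + 1) y y0.
  move=> /(is_deriveZ (b + 1)^-1).
  by rewrite /GRing.scale/= mulrA mulVf// mul1r addrK.
have cF (y : R) : 0 < y -> {for y, continuous F}.
  by move=> y0; apply/differentiable_continuous/derivable1_diffP; case: (dF y y0).
rewrite (@continuous_FTC2 R _ F)//.
- by rewrite /F ![_ * (b + 1)^-1]mulrC.
- apply: continuous_in_subspaceT => y; rewrite inE/= in_itv/= => /andP[uy _].
  apply/differentiable_continuous/derivable1_diffP; apply: derivable_powR.
  by rewrite in_itv/= andbT (lt_le_trans u0).
- split.
  + move=> y; rewrite in_itv/= => /andP[uy _].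
    by case: (dF y (lt_trans u0 uy)).
  + exact/cvg_at_right_filter/cF.
  + exact/cvg_at_left_filter/cF/(lt_trans u0).
- move=> y; rewrite in_itv/= => /andP[uy _].
  by rewrite derive1E; case: (dF y (lt_trans u0 uy)).
Qed.

(** The integrand may blow up at 0, so the interval is exhausted from the right by compact ones, and
    monotone convergence applies; b + 1 > 0 makes the boundary term at 0 vanish in the limit. *)
Lemma integral_powR_itv0 (R : realType) (b L : R) : -1 < b -> 0 < L ->
  (\int[lebesgue_measure]_(y in `]0%R, L[) (y `^ b)%:E =
   (L `^ (b + 1) / (b + 1))%:E)%E.
Proof.
move=> b1 L0; have b10 : 0 < b + 1 by rewrite -ltrBlDr sub0r.
have mpow (D : set R) : measurable_fun D (fun y : R => (y `^ b)%:E).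
  by apply/measurable_EFinP/measurable_funTS; exact: measurable_powR.
(* This is L / (n + 2); the shift keeps even the first term strictly below L. *)
pose u n : R := L * harmonic n.+1.
have u0 n : 0 < u n by rewrite mulr_gt0// /harmonic/= invr_gt0.
have uL n : u n < L.
  by rewrite /u /harmonic/= gtr_pMr// invf_lt1// ltr1n.
have cu : u @ \oo --> (0 : R).
  rewrite -(mulr0 L); apply: cvgM; first exact: cvg_cst.
  by have := @cvg_harmonic R; rewrite -cvg_shiftS.
pose F n : set R := `[u n, L]%classic.
have ndF : nondecreasing_seq F.
  apply/nondecreasing_seqP => n; rewrite subsetEset => y; rewrite /F/= !in_itv/=.
  move=> /andP[uy ->]; rewrite andbT; apply: le_trans uy.
  by rewrite /u /harmonic/= ler_pM2l// lef_pV2 ?posrE// ler_nat.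
have -> : (\int[lebesgue_measure]_(y in `]0%R, L[) (y `^ b)%:E =
          \int[lebesgue_measure]_(y in \bigcup_n F n) (y `^ b)%:E)%E.
  rewrite -(@integral_itv_bndoo _ _ _ _ false false)//; congr integral.
  apply/seteqP; split => y; last first.
    by move=> [n _]; rewrite /F/= !in_itv/= => /andP[uy ->]; rewrite (lt_le_trans (u0 n)).
  rewrite /= in_itv/= => /andP[y0 yL].
  have /cvgrPdist_lt/(_ y y0)[n _ /(_ n (leqnn n))] := cu.
  rewrite /= sub0r normrN gtr0_norm// => uny.
  by exists n => //; rewrite /F/= in_itv/= yL ltW.
have := @ge0_nondecreasing_set_cvg_integral _ (measurableTypeR R) R F (fun y => (y `^ b)%:E)
  lebesgue_measure ndF.
move=> cF; have {}cF := cF (fun=> measurable_itv _) (fun=> mpow _)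
  (fun i x _ => (powR_ge0 _ _ : (0%:E <= (x `^ b)%:E)%E)).
rewrite -(cvg_lim _ cF)//; apply/cvg_lim => //.
have -> : (fun n => (\int[lebesgue_measure]_(y in F n) (y `^ b)%:E)%E) =
          EFin \o (fun n => L `^ (b + 1) / (b + 1) - u n `^ (b + 1) / (b + 1)).
  by apply/funext => n; rewrite /F integral_powR_itvcc.
apply: cvg_EFin; first exact: nearW.
rewrite -[X in _ --> X]subr0 -[X in _ - X](mul0r (b + 1)^-1).
apply: cvgB; first exact: cvg_cst.
apply: cvgM; last exact: cvg_cst.
by have /cvg_at_rightP := powR_cvg0 b10; apply.
Qed.

(** * Carleson squares, their masses, and the grid intervals *)

Section carleson_squares.
Context (R : realType).
Implicit Types (I : set R) (b l : R).

(** Monotonicity of Lebesgue measure on [x, y] inside I. Boundedness makes the measure of I finite,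
    so that [fine] in [length] does not collapse it to 0. *)
Lemma bounded_interval_dist I (x y : R) : bounded_interval I ->
  I x -> I y -> y - x <= length I.
Proof.
move=> [itvI bI lI] Ix Iy; have [xy|yx] := leP y x.
  by rewrite (le_trans _ (ltW lI))// subr_le0.
have sub : `[x, y]%classic `<=` I.
  by move=> z /=; rewrite in_itv/= => /andP[xz zy]; apply: (itvI _ _ Ix Iy); rewrite xz zy.
have mI : measurable (I : set (measurableTypeR R)) by exact: is_interval_measurable.
have [M [_ IM]] := bI.
have fI : (lebesgue_measure I < +oo)%E.
  apply: (@le_lt_trans _ _ (lebesgue_measure `[- (`|M| + 1), `|M| + 1]%classic)).
    apply: le_measure; rewrite ?inE//.
    move=> z Iz; have : `|z| <= `|M| + 1.
      by apply: IM Iz; rewrite (le_lt_trans (ler_norm _))// ltrDl.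
    by rewrite /= in_itv/= ler_norml.
  by rewrite lebesgue_measure_itv/=; case: ifP => _; rewrite ?ltry.
rewrite -lee_fin /length fineK ?ge0_fin_numE//.
rewrite (_ : (y - x)%:E = lebesgue_measure `[x, y]%classic); last first.
  by rewrite lebesgue_measure_itv/= lte_fin yx.
by apply: le_measure; rewrite ?inE.
Qed.

(** A positive length already excludes infinite measure, since [fine] sends +oo to 0. *)
Lemma lebesgue_measure_bounded_interval I : bounded_interval I ->
  lebesgue_measure I = (length I)%:E.
Proof.
move=> [_ _ lI]; rewrite /length fineK//; move: lI; rewrite /length.
by case: (lebesgue_measure I) => //=; rewrite ltxx.
Qed.

Lemma measurable_carleson_square I : is_interval I ->
  measurable (carleson_square I : set (plane R)).
Proof.
move=> itvI.
rewrite (_ : carleson_square I = I `*` `]0%R, length I[%classic); last first.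
  by apply/seteqP; split => -[x y] /=; rewrite in_itv.
by apply: measurableX => //; exact: is_interval_measurable.
Qed.

Lemma measurable_upper_half_plane :
  measurable (@upper_half_plane R : set (plane R)).
Proof.
rewrite (_ : @upper_half_plane R = setT `*` `]0%R, +oo[%classic).
  by apply: measurableX => //; exact: measurable_itv.
by apply/seteqP; split => -[x y] /=; rewrite in_itv/= andbT//; case.
Qed.

Lemma carleson_square_sub_upper I :
  carleson_square I `<=` @upper_half_plane R.
Proof. by move=> z [_ /andP[]]. Qed.

Lemma measurable_powR_snd b (D : set (plane R)) :
  measurable_fun D (fun z : plane R => z.2 `^ b).
Proof.
apply: measurable_funTS.
apply: (@measurableT_comp _ _ _ _ _ _ (@powR R ^~ b) _ (snd : plane R -> _)).
  exact: measurable_powR.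
exact: measurable_snd.
Qed.

(** Tonelli: the inner integral in y is constant for x in I. The exponent b is general because the
    Hoelder estimate also involves the mass of a square for a lower power of y. *)
Lemma carleson_areaE I b : -1 < b -> bounded_interval I ->
  carleson_area b I = (length I `^ (b + 2) / (b + 1))%:E.
Proof.
move=> b1 bI; have [itvI _ lI] := bI.
rewrite /carleson_area /intV integral_mkcond /area.
set f := patch _ _ _.
have f0 z : (0 <= f z)%E.
  by rewrite /f patchE; case: ifP => // _; rewrite mul1e lee_fin powR_ge0.
have mf : measurable_fun setT (f : plane R -> _).
  apply/(measurable_restrictT _ (measurable_carleson_square itvI)).
  rewrite (_ : (fun z => _) = EFin \o (fun z : plane R => z.2 `^ b)).
    by apply/measurable_EFinP; exact: measurable_powR_snd.
  by apply/funext => z; rewrite mul1e.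
rewrite (fubini_tonelli1 f mf f0).
have -> : fubini_F lebesgue_measure f =
    (fun=> (length I `^ (b + 1) / (b + 1))%:E)%E \_ I.
  apply/funext => x; rewrite /fubini_F patchE; case: ifPn => xI.
    rewrite -integral_powR_itv0// [RHS]integral_mkcond; apply: eq_integral => y _.
    rewrite /f !patchE mul1e; congr (if _ then _ else _).
    apply/idP/idP => /set_mem h; apply/mem_set.
      by case: h => _; rewrite /= in_itv.
    by split; [exact: set_mem|move: h; rewrite /= in_itv].
  apply: integral0_eq => y _; rewrite /f patchE memNset//= => -[Ix _].
  by move: xI; rewrite notin_setE.
rewrite -integral_mkcond integral_cst; last exact: is_interval_measurable.
have lIE := lebesgue_measure_bounded_interval bI; rewrite /= in lIE.
rewrite [X in (_ * X)%E](_ : _ = (length I)%:E)//.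
rewrite -EFinM mulrAC (_ : b + 2 = (b + 1) + 1); last by rewrite -addrA.
by rewrite [in RHS]powRD ?[in RHS]powRr1 ?(ltW lI)//; apply/implyP => _; rewrite gt_eqF.
Qed.

(** Neighbours of the same generation overlap by half. Disjoint dyadic intervals would not do: a
    short interval around 0 lies in none of them. *)
Definition grid_interval (k m : int) : set R :=
  `[m%:~R * 2 ^ k, (m%:~R + 2) * 2 ^ k[%classic.

Lemma length_grid_interval k m : length (grid_interval k m) = 2 ^ (k + 1).
Proof.
rewrite /length /grid_interval lebesgue_measure_itv/= lte_fin.
rewrite ltr_pM2r ?exprz_gt0// ltrDl ltr0n/= -mulrBl addrAC subrr add0r.
by rewrite expfzDr// mulrC.
Qed.

Lemma bounded_grid_interval k m : bounded_interval (grid_interval k m).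
Proof.
split; first exact: interval_is_interval.
- exists (`|m%:~R * 2 ^ k| + `|(m%:~R + 2) * 2 ^ k|); split; first exact: num_real.
  move=> M /ltW MB x; rewrite /grid_interval/= in_itv/= => /andP[ax xb].
  apply: le_trans MB; rewrite ler_norml.
  set u := m%:~R * _ in ax *; set v := _ * _ in xb *.
  have := ler_norm v; have := lerNnormlW (lexx `|u|).
  have := normr_ge0 u; have := normr_ge0 v; lra.
- by rewrite length_grid_interval exprz_gt0.
Qed.

(** Take k with |I| <= 2^k <= 2 |I|, and m with inf I in [m 2^k, (m + 1) 2^k[. Then I ends before (m
    + 2) 2^k, and the grid interval has length 2 * 2^k <= 4 |I|. *)
Lemma grid_interval_cover I : bounded_interval I ->
  exists k m : int, [/\ I `<=` grid_interval k m,
    length I <= length (grid_interval k m) &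
    length (grid_interval k m) <= 4 * length I].
Proof.
move=> bI; have [itvI [M [_ IM]] lI] := bI.
have ln2 : 0 < ln (2 : R) by rewrite ln_gt0// ltr1n.
pose k := Num.ceil (ln (length I) / ln 2).
have lE : length I = 2 `^ (ln (length I) / ln 2).
  by rewrite /powR gt_eqF// divfK ?gt_eqF// lnK.
have kle : length I <= 2 ^ k.
  by rewrite lE -powR_intmul// ler_powR ?ler1n// ceil_ge.
have kgt : 2 ^ k <= 2 * length I.
  rewrite [in leRHS]lE -[X in X * _ `^ _](powRr1 (ler0n R 2)) -powRD; last first.
    by rewrite pnatr_eq0 implybT.
  rewrite -powR_intmul// ler_powR ?ler1n// -lerBlDl ltW//.
  by have := ceil_itv (ln (length I) / ln 2); rewrite -/k => /andP[]; rewrite intrD.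
have I0 : I !=set0.
  apply/set0P/eqP => I0; move: lI; rewrite /length I0 measure0/= ltxx //.
have lbI : has_lbound I.
  exists (- (`|M| + 1)) => x Ix; apply: lerNnormlW.
  by apply: IM Ix; rewrite (le_lt_trans (ler_norm _))// ltrDl.
pose c := inf I; pose m := Num.floor (c / 2 ^ k).
have k0 : 0 < (2 : R) ^ k by rewrite exprz_gt0.
have /andP[mc cm] : m%:~R * 2 ^ k <= c < (m%:~R + 1) * 2 ^ k.
  by rewrite -ler_pdivlMr// -ltr_pdivrMr// -intrD1 floor_itv.
have cI x : I x -> x <= c + length I.
  move=> Ix; rewrite -lerBlDr; apply: lb_le_inf => // y Iy.
  by rewrite lerBlDr -lerBlDl; exact: bounded_interval_dist.
exists k, m; split.
- move=> x Ix; rewrite /grid_interval/= in_itv/=; apply/andP; split.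
    by rewrite (le_trans mc)//; exact: ge_inf.
  apply: le_lt_trans (cI x Ix) _.
  rewrite -[2]/(1 + 1) addrA [ltRHS]mulrDl mul1r; exact: ltr_leD.
- rewrite length_grid_interval expfzDr// (le_trans kle)//.
  by rewrite ler_peMr ?ler1n// ltW.
- rewrite length_grid_interval expfzDr// mulrC.
  by rewrite (natrM _ 2 2) -mulrA ler_pM2l.
Qed.

End carleson_squares.

(** * Sums of powers, geometric sums, and the overlap of the grid squares *)

Lemma lee_poweR (R : realType) (r : R) (x y : \bar R) : 0 <= r ->
  (0 <= x -> x <= y -> x `^ r <= y `^ r)%E.
Proof.
by move=> r0 x0 xy; apply: gt0_ler_poweR => //;
  rewrite in_itv/= leey andbT// (le_trans x0).
Qed.

(** For finite values, x^t = x x^(t - 1) <= x (x + y)^(t - 1), and likewise for y; add the two. *)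
Lemma poweR_superadditive (R : realType) (t : R) (x y : \bar R) : 1 <= t ->
  (0 <= x -> 0 <= y -> x `^ t + y `^ t <= (x + y) `^ t)%E.
Proof.
move=> t1; have t0 : 0 < t by exact: lt_le_trans t1.
have [->|xNy] := eqVneq x +oo%E.
  by move=> _ y0; rewrite [X in (_ <= X `^ _)%E]addye ?gt_eqF ?(lt_le_trans _ y0)//
    poweRyr ?gt_eqF// leey.
have [->|yNy] := eqVneq y +oo%E.
  by move=> x0 _; rewrite [X in (_ <= X `^ _)%E]addey ?gt_eqF ?(lt_le_trans _ x0)//
    poweRyr ?gt_eqF// leey.
case: x xNy => [x||]//; case: y yNy => [y||]// _ _ x0 y0.
  rewrite lee_fin; rewrite !lee_fin in x0 y0.
  rewrite -!(mulr_powRB1 _ t0) ?addr_ge0// mulrDl.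
  by apply: lerD; apply: ler_wpM2l => //; apply: ge0_ler_powR;
    rewrite ?subr_ge0 ?nnegrE ?addr_ge0 ?lerDl ?lerDr.
Qed.

(** Superadditivity, iterated. It is applied with t = q / p, and this is where p <= q enters. *)
Lemma sum_poweR_le (R : realType) (I : Type) (s : seq I) (t : R)
    (x : I -> \bar R) : 1 <= t -> (forall i, 0 <= x i)%E ->
  (\sum_(i <- s) x i `^ t <= (\sum_(i <- s) x i) `^ t)%E.
Proof.
move=> t1 x0; elim: s => [|i s IH]; first by rewrite !big_nil poweR_ge0.
rewrite !big_cons; apply: le_trans (poweR_superadditive t1 _ _) => //.
  exact: leeD2l.
exact: sume_ge0.
Qed.

(** Distinct exponents pick out part of the geometric series. The induction is on a strict bound n
    of the exponents, with the sharper claim that the sum times 1 - rho is at most 1 - rho^n. *)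
Lemma sum_geometric_uniq (R : realType) (rho : R) (s : seq nat) :
  0 <= rho -> rho < 1 -> uniq s -> \sum_(j <- s) rho ^+ j <= (1 - rho)^-1.
Proof.
move=> r0 r1 us; rewrite -[leRHS]mul1r ler_pdivlMr ?subr_gt0//.
have [n sn] : exists n, all (ltn^~ n) s.
  exists (\sum_(j <- s) j).+1; apply/allP => j js.
  by rewrite /= ltnS (big_rem j)//= leq_addr.
apply: (@le_trans _ _ (1 - rho ^+ n)); last by rewrite gerBl exprn_ge0.
elim: n s us sn => [|n IH] s us sn.
  by case: s us sn => //= _; rewrite big_nil mul0r subrr.
have [ns|ns] := boolP (n \in s).
  rewrite (big_rem n)//= mulrDl.
  have := IH (rem n s) (rem_uniq _ us).
  have -> : all (ltn^~ n) (rem n s).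
    apply/allP => j; rewrite mem_rem_uniq// inE => /andP[jn js].
    by move/allP : sn => /(_ _ js); rewrite /= ltnS leq_eqVlt (negPf jn).
  by move=> /(_ isT); rewrite exprS; lra.
apply: le_trans (IH s us _) _.
  apply/allP => j js; move/allP : (sn) => /(_ _ js); rewrite /= ltnS leq_eqVlt.
  by case: eqP => // jn; move: ns; rewrite -jn js.
by rewrite lerD2l lerN2 exprS ler_piMl ?exprn_ge0// ltW.
Qed.

Lemma sum_grid_overlap (R : realType) (d : R) : 0 < d ->
  exists2 c : R, 0 < c & forall (z : R * R) (s : seq (int * int)), uniq s ->
    \sum_(i <- s) \1_(carleson_square (grid_interval i.1 i.2)) z *
      (z.2 / 2 ^ (i.1 + 1)) `^ d <= c.
Proof.
move=> d0; pose rho : R := 2 `^ (- d).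
have r0 : 0 < rho by rewrite powR_gt0.
have r1 : rho < 1.
  by rewrite /rho /powR pnatr_eq0/= expR_lt1 mulNr oppr_lt0 mulr_gt0// ln_gt0// ltr1n.
exists ((1 - rho)^-1 *+ 2); first by rewrite pmulrn_lgt0// invr_gt0 subr_gt0.
move=> [x y] s us.
pose P (i : int * int) := `[< carleson_square (grid_interval i.1 i.2) (x, y) >].
have [y0|y0] := leP y 0.
  rewrite big1 ?mulrn_wge0 ?invr_ge0 ?subr_ge0 ?ltW// => i _.
  by rewrite indicE memNset ?mul0r// => -[_] /=; rewrite ltNge y0.
(* A square over a grid interval (k, m) contains (x, y) only if k >= k0 and m is
   floor (x / 2^k) or floor (x / 2^k) - 1. *)
pose k0 := Num.floor (ln y / ln 2).
have ln2_ : 0 < ln (2 : R) by rewrite ln_gt0// ltr1n.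
have yE : y = 2 `^ (ln y / ln 2).
  by rewrite /powR gt_eqF// divfK ?gt_eqF// lnK.
have Pk (i : int * int) : P i -> k0 <= i.1.
  move=> /asboolP[_] /=; rewrite y0/= length_grid_interval -powR_intmul//.
  rewrite [X in X < _]yE => h; rewrite -ltzD1 -(ltr_int R).
  have : ln y / ln 2 < (i.1 + 1)%:~R.
    by rewrite ltNge; apply/negP => /(ler_powR (ler1n R 2)); rewrite leNgt h.
  by apply: le_lt_trans; exact: floor_le.
(* Since y <= 2^(k0 + 1), the quotient y / 2^(k + 1) is at most 2^(k0 - k). *)
have bnd (i : int * int) : P i -> (y / 2 ^ (i.1 + 1)) `^ d <= rho ^+ `|i.1 - k0|%N.
  move=> Pi; have ki := Pk i Pi.
  rewrite -powR_mulrn ?(ltW r0)// /rho -powRrM mulNr [d * _]mulrC -mulNr powRrM.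
  apply: (ge0_ler_powR (ltW d0)); rewrite ?nnegrE ?powR_ge0// ?divr_ge0 ?exprz_ge0 ?(ltW y0)//.
  rewrite ler_pdivrMr ?exprz_gt0// -powR_intmul// -powRD; last first.
    by rewrite pnatr_eq0 implybT.
  rewrite [X in X <= _]yE natr_absz ger0_norm ?subr_ge0// ler_powR ?ler1n//.
  have := floorD1_gt (ln y / ln 2); rewrite -/k0 !intrD intrN; lra.
(* The flag b separates the two possible values of m. Within one class k determines m, so the
   exponents k - k0 are distinct and a single geometric series bounds the sum. *)
have half (b : bool) :
    \sum_(i <- s | P i && ((Num.floor (x / 2 ^ i.1) == i.2) == b))
      (y / 2 ^ (i.1 + 1)) `^ d <= (1 - rho)^-1.
  apply: (@le_trans _ _ (\sum_(i <- s | P i && ((Num.floor (x / 2 ^ i.1) == i.2) == b))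
      rho ^+ `|i.1 - k0|%N)).
    by apply: ler_sum => i /andP[Pi _]; exact: bnd.
  rewrite -big_filter -(big_map (fun i : int * int => `|i.1 - k0|%N) predT
     (fun j => rho ^+ j)).
  apply: sum_geometric_uniq => //; first exact: ltW.
  rewrite map_inj_in_uniq ?filter_uniq// => -[k m] [k' m'].
  rewrite !mem_filter/= => /andP[/andP[Pi bi] _] /andP[/andP[Pj bj] _] kk.
  have kk' : k = k'.
    have := Pk _ Pi; have := Pk _ Pj; move: kk => /=; lia.
  subst k'; congr pair.
  have fl (n : int) : P (k, n) -> Num.floor (x / 2 ^ k) = n \/ Num.floor (x / 2 ^ k) = n + 1.
    move=> /asboolP[/=]; rewrite /grid_interval/= in_itv/= => /andP[nx xn] _.
    have k20 : 0 < (2 : R) ^ k by rewrite exprz_gt0.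
    have : (n <= Num.floor (x / 2 ^ k)) by rewrite floor_ge_int ler_pdivlMr.
    have : (Num.floor (x / 2 ^ k) < n + 2).
      by rewrite floor_lt_int intrD ltr_pdivrMr.
    by clear; lia.
  have := fl _ Pi; have := fl _ Pj; move: bi bj; case: b => /eqP + /eqP.
    by move=> /eqP -> /eqP ->.
  by move=> /eqP + /eqP; clear; lia.
rewrite mulr2n; apply: le_trans (lerD (half true) (half false)).
rewrite (eq_bigr (fun i => if P i then (y / 2 ^ (i.1 + 1)) `^ d else 0)).
  rewrite -big_mkcond/= (bigID (fun i => Num.floor (x / 2 ^ i.1) == i.2))/=.
  apply: lerD; rewrite le_eqVlt; apply/orP; left; apply/eqP; apply: eq_bigl => i.
    by rewrite eqb_id.
  by rewrite eqbF_neg.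
move=> i _; rewrite indicE /P; case: ifPn => [/asboolP h|/asboolP h].
  by rewrite mem_set// mul1r.
by rewrite memNset// mul0r.
Qed.

(** * Hoelder's inequality on one square *)

Section square_estimate.
Context (R : realType).
Implicit Types (phi w : R * R -> R) (Q : set (R * R)).

Lemma measurable_neg_power (w : plane R -> R) (s : R) (D : set (plane R)) :
  measurable D -> measurable_fun D w -> measurable_fun D (neg_power w s).
Proof.
move=> mD mw; have mws : measurable_fun D (fun z => w z `^ s).
  exact: (@measurableT_comp _ _ _ _ _ _ (@powR R ^~ s)).
rewrite (_ : neg_power w s =
  fun z => if w z `^ s == 0 then +oo%E else (w z `^ (- s))%:E); last first.
  by apply/funext => z; rewrite /neg_power inver powRN.
apply: measurable_fun_if => //.
  apply: (@measurable_fun_bool _ _ _ _ true).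
  rewrite (_ : _ @^-1` _ = (fun z => w z `^ s) @^-1` [set 0]).
    exact: mws.
  by apply/seteqP; split => z /=; [move/eqP|move=> ->; rewrite eqxx].
apply/measurable_EFinP; apply: (measurable_funS mD); first exact: subIsetl.
exact: (@measurableT_comp _ _ _ _ _ _ (@powR R ^~ (- s))).
Qed.

Lemma neg_power_ge0 w (s : R) z : (0 <= neg_power w s z)%E.
Proof. by rewrite /neg_power inve_ge0 lee_fin powR_ge0. Qed.

(** Where w vanishes, [neg_power] is +oo and y^a is positive, so the integrand is +oo there; an
    integrable function is finite almost everywhere. *)
Lemma intV_neg_power_ae_gt0 (w : plane R -> R) (a s : R) (Q : set (plane R)) : 0 < s ->
  measurable Q -> Q `<=` @upper_half_plane R ->
  measurable_fun Q w -> (forall z, Q z -> 0 <= w z) ->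
  (intV a Q (neg_power w s) < +oo)%E ->
  {ae area R, forall z, Q z -> 0 < w z}.
Proof.
move=> s0 mQ Qu mw w0 fin.
have int : (area R).-integrable Q (fun z : plane R => neg_power w s z * (z.2 `^ a)%:E)%E.
  apply/integrableP; split.
    apply: emeasurable_funM; first exact: measurable_neg_power.
    by apply/measurable_EFinP; exact: measurable_powR_snd.
  rewrite (eq_integral (fun z : plane R => neg_power w s z * (z.2 `^ a)%:E)%E)// => z _.
  by rewrite gee0_abs// mule_ge0 ?neg_power_ge0// lee_fin powR_ge0.
apply: filterS (integrable_ae mQ int) => z + Qz => /(_ Qz).
rewrite lt_neqAle w0// andbT; apply: contraTneq => wz0.
rewrite /neg_power -wz0 powR0 ?gt_eqF// inve0 gt0_mulye// lte_fin powR_gt0//.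
exact: Qu.
Qed.

(** Two Hoelder steps, with exponents p, p' and then r, r'. The inserted factor y^e lowers the power
    of y in the last integral; in return the first integral gains y^(e p), the decay that makes the
    sum over all squares converge. *)
Lemma intV_hoelder (phi w : plane R -> R) (a e p p' r r' : R) (Q : set (plane R)) :
  0 < p -> 0 < p' -> p^-1 + p'^-1 = 1 ->
  0 < r -> 0 < r' -> r^-1 + r'^-1 = 1 ->
  measurable Q -> Q `<=` @upper_half_plane R ->
  measurable_fun Q phi -> measurable_fun Q w ->
  (forall z, Q z -> 0 <= phi z) -> (forall z, Q z -> 0 <= w z) ->
  (intV a Q (neg_power w (p' * r)) < +oo)%E ->
  (intV a Q (EFin \o phi) <=
   intV a Q (fun z => ((phi z * w z) `^ p * z.2 `^ (e * p))%:E) `^ p^-1 *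
   (intV a Q (neg_power w (p' * r)) `^ (p' * r)^-1 *
    intV (a - e * p' * r') Q (fun=> 1%E) `^ (p' * r')^-1))%E.
Proof.
move=> p0 p'0 pp' r0 r'0 rr' mQ Qu mphi mw phi0 w0 fin.
have y0 z : Q z -> 0 < z.2 by exact: Qu.
have mpw (g : plane R -> R) s : measurable_fun Q g -> measurable_fun Q (fun z => g z `^ s).
  by move=> mg; exact: (@measurableT_comp _ _ _ _ _ _ (@powR R ^~ s)).
have my s : measurable_fun Q (fun z : plane R => z.2 `^ s) by exact: measurable_powR_snd.
(* The first Hoelder step splits phi as u * (v1 * v2), the second splits
   v1^p' * v2^p'. *)
pose u (z : plane R) := phi z * w z * z.2 `^ e.
pose v1 (z : plane R) := w z `^ (- 1).
pose v2 (z : plane R) := z.2 `^ (- e).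
pose h (z : plane R) := z.2 `^ a.
have mu_ : measurable_fun Q u.
  by apply: measurable_funM => //; apply: measurable_funM.
have mv : measurable_fun Q (fun z => v1 z * v2 z).
  by apply: measurable_funM; [exact: (mpw w)|exact: my].
have u0 z : Q z -> 0 <= u z by move=> Qz; rewrite /u !mulr_ge0 ?phi0 ?w0 ?powR_ge0.
have v0 z : Q z -> 0 <= v1 z * v2 z by rewrite mulr_ge0 ?powR_ge0.
have h0 z : Q z -> 0 <= h z by rewrite powR_ge0.
have H1 := hoelder_weighted (area R) mQ mu_ mv (my a) u0 v0 h0 p0 p'0 pp'.
(* As [powR] gives 0^(-1) = 0, the factorization of phi can fail where w vanishes; finiteness of the
   integral makes that set null. *)
have wae := intV_neg_power_ae_gt0 (mulr_gt0 p'0 r0) mQ Qu mw w0 fin.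
have -> : intV a Q (EFin \o phi) =
    (\int[area R]_(z in Q) (u z * (v1 z * v2 z) * h z)%:E)%E.
  rewrite /intV; apply: ae_eq_integral_ge0 => //.
  - apply/measurable_EFinP; apply: (measurable_funM _ (my a)).
    exact: (measurable_funM mu_ mv).
  - by move=> z Qz; rewrite mule_ge0 ?lee_fin ?powR_ge0 ?phi0.
  - by move=> z Qz; rewrite lee_fin mulr_ge0 ?h0// mulr_ge0 ?u0 ?v0.
  apply: filterS wae => z + Qz => /(_ Qz) wz0.
  rewrite -EFinM; congr (_%:E); congr (_ * _).
  rewrite /u /v1 /v2 powR_inv1 ?(ltW wz0)// powRN.
  have yz0 : z.2 `^ e != 0 by rewrite gt_eqF// powR_gt0// y0.
  by field; rewrite yz0 gt_eqF.
apply: (le_trans H1).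
have -> : (\int[area R]_(z in Q) (u z `^ p * h z)%:E =
    intV a Q (fun z => ((phi z * w z) `^ p * z.2 `^ (e * p))%:E))%E.
  apply: eq_integral => z; rewrite inE => Qz.
  by rewrite -EFinM /u powRM ?mulr_ge0 ?phi0 ?w0 ?powR_ge0// -powRrM.
apply: lee_pmul => //; try exact: poweR_ge0.
have mv1 : measurable_fun Q (fun z => v1 z `^ p') by apply: (mpw); apply: (mpw).
have mv2 : measurable_fun Q (fun z => v2 z `^ p') by apply: (mpw); exact: my.
have v10 z : Q z -> 0 <= v1 z `^ p' by rewrite powR_ge0.
have v20 z : Q z -> 0 <= v2 z `^ p' by rewrite powR_ge0.
have H2 := hoelder_weighted (area R) mQ mv1 mv2 (my a) v10 v20 h0 r0 r'0 rr'.
(* The common outer exponent 1 / p' is pulled out, so that the second Hoelder inequality can be used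
   under it. *)
rewrite !invfM ![(p'^-1 * _)]mulrC !poweRrM -poweRM ?poweR_ge0//.
apply: lee_poweR; first by rewrite invr_ge0 ltW.
  by apply: integral_ge0 => z Qz; rewrite lee_fin mulr_ge0 ?powR_ge0.
rewrite (eq_integral (fun z : plane R => (v1 z `^ p' * v2 z `^ p' * z.2 `^ a)%:E)); last first.
  by move=> z _; rewrite powRM ?powR_ge0.
apply: (le_trans H2); apply: lee_pmul; try exact: poweR_ge0.
- apply: lee_poweR; first by rewrite invr_ge0 ltW.
    by apply: integral_ge0 => z Qz; rewrite lee_fin mulr_ge0 ?powR_ge0.
  apply: le_integral_ge0 => z Qz; first by rewrite lee_fin mulr_ge0 ?powR_ge0.
  rewrite EFinM; apply: lee_wpmul2r; first by rewrite lee_fin powR_ge0.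
  rewrite /v1 (_ : _ `^ r = w z `^ (- (p' * r))); last first.
    by rewrite -!powRrM; congr powR; ring.
  (* Only an inequality: where w vanishes, the left side is 0 and the right side +oo. *)
  by rewrite powRN /neg_power inver; case: ifPn => // _; rewrite leey.
- rewrite /intV le_eqVlt; apply/orP; left; apply/eqP; congr poweR.
  apply: eq_integral => z; rewrite inE => Qz; rewrite mul1e; congr EFin.
  rewrite /v2 -!powRrM -powRD; last by apply/implyP => _; rewrite gt_eqF ?y0.
  by congr powR; ring.
Qed.

End square_estimate.

(** * Borel representatives of Lebesgue measurable functions *)

Lemma ae_eq_intV (R : realType) (a : R) (D : set (plane R)) (f g : plane R -> \bar R) :
  measurable D -> measurable_fun D g ->
  (forall z, D z -> (0 <= f z)%E) -> (forall z, D z -> (0 <= g z)%E) ->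
  {ae area R, forall z, D z -> f z = g z} -> intV a D f = intV a D g.
Proof.
move=> mD mg f0 g0 fg; rewrite /intV; apply: ae_eq_integral_ge0.
- exact: mD.
- apply: emeasurable_funM mg _; apply/measurable_EFinP.
  exact: measurable_powR_snd.
- by move=> z Dz; rewrite mule_ge0 ?f0// lee_fin powR_ge0.
- by move=> z Dz; rewrite mule_ge0 ?g0// lee_fin powR_ge0.
apply: (@filterS _ _ (ae_filter_ringOfSetsType (area R)) _ _ _ fg).
by move=> z + Dz => /(_ Dz) ->.
Qed.

(** Taking the absolute value of a Borel representative makes it nonnegative everywhere, not just
    almost everywhere. *)
Lemma Lebesgue_measurable_fun_ge0 (R : realType) (D : set (R * R)) (w : R * R -> R) :
  Lebesgue_measurable_fun D w -> (forall z, D z -> 0 <= w z) ->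
  exists v : plane R -> R, [/\ measurable_fun (D : set (plane R)) v,
    forall z, 0 <= v z & {ae area R, forall z, D z -> w z = v z}].
Proof.
move=> [g mg wg] w0; exists (fun z => `|g z|); split => //.
  exact: measurableT_comp.
apply: (@filterS _ _ (ae_filter_ringOfSetsType (area R)) _ _ _ wg).
by move=> z + Dz => /(_ Dz) <-; rewrite ger0_norm// w0.
Qed.

Lemma Lebesgue_measurable_cabs (R : realType) (D : set (R * R)) (f : R * R -> R[i]) :
  Lebesgue_measurable_funC D f ->
  exists v : plane R -> R, [/\ measurable_fun (D : set (plane R)) v,
    forall z, 0 <= v z & {ae area R, forall z, D z -> cabs (f z) = v z}].
Proof.
move=> [[g mg fg] [h mh fh]].
exists (fun z => (g z * g z + h z * h z) `^ 2^-1); split.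
- apply: (@measurableT_comp _ _ _ _ _ _ (@powR R ^~ 2^-1)).
    exact: measurable_powR.
  by apply: measurable_funD; apply: measurable_funM.
- by move=> z; rewrite powR_ge0.
apply: (@filterS2 _ _ (ae_filter_ringOfSetsType (area R)) _ _ _ _ fg fh).
move=> z + + Dz => /(_ Dz) <- /(_ Dz) <-.
rewrite powR12_sqrt; last by rewrite -!expr2 addr_ge0 ?sqr_ge0.
by rewrite /cabs; case: (f z).
Qed.

(** * Summation over the grid *)

(** After exchanging sum and integral, g y^a is multiplied by the sum of (y / |J|)^d over the listed
    squares containing the point, which [sum_grid_overlap] bounds uniformly. *)
Lemma grid_embedding (R : realType) (a d : R) : 0 < d ->
  exists2 c : R, 0 < c &
    forall g : plane R -> R, measurable_fun (@upper_half_plane R : set (plane R)) g ->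
    (forall z, upper_half_plane z -> 0 <= g z) ->
    forall s : seq (int * int), uniq s ->
    (\sum_(i <- s) ((length (@grid_interval R i.1 i.2) `^ (- d))%:E *
        intV a (carleson_square (@grid_interval R i.1 i.2))
          (fun z => (g z * z.2 `^ d)%:E))
     <= c%:E * intV a (@upper_half_plane R) (EFin \o g))%E.
Proof.
move=> d0; have [c c0 cP] := sum_grid_overlap d0; exists c => // g mg g0 s us.
set H := @upper_half_plane R.
have mH : measurable (H : set (plane R)) by exact: measurable_upper_half_plane.
pose Q (i : int * int) := carleson_square (@grid_interval R i.1 i.2).
have mQ i : measurable (Q i : set (plane R)).
  by apply: measurable_carleson_square; case: (bounded_grid_interval R i.1 i.2).
have my s (D : set (plane R)) := @measurable_powR_snd R s D.
pose F i (z : plane R) := (\1_(Q i) z * (z.2 / 2 ^ (i.1 + 1)) `^ d * (g z * z.2 `^ a))%:E.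
have F0 i z : H z -> (0 <= F i z)%E.
  by move=> Hz; rewrite lee_fin !mulr_ge0 ?powR_ge0 ?g0.
have mF i : measurable_fun (H : set (plane R)) (F i).
  apply/measurable_EFinP; apply: measurable_funM; last exact: measurable_funM.
  apply: measurable_funM; first exact: measurable_indic.
  apply: (@measurableT_comp _ _ _ _ _ _ (@powR R ^~ d)); first exact: measurable_powR.
  by apply: measurable_funM => //; apply: measurable_funTS; exact: measurable_snd.
rewrite (eq_bigr (fun i => \int[area R]_(z in H) F i z)%E); last first.
  move=> i _; rewrite -/(Q i) /intV -ge0_integralZl//; last 3 first.
  - apply: emeasurable_funM; apply/measurable_EFinP; last exact: my.
    apply: measurable_funM; last exact: my.
    by apply: (measurable_funS mH) mg; exact: carleson_square_sub_upper.
  - move=> z /carleson_square_sub_upper Hz.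
    by rewrite mule_ge0 ?lee_fin ?mulr_ge0 ?powR_ge0 ?g0.
  - by rewrite lee_fin powR_ge0.
  rewrite [LHS]integral_mkcond [RHS]integral_mkcond; apply: eq_integral => z _.
  rewrite !patchE /F indicE; case: ifPn => [|zQ]; last first.
    by rewrite !mul0r; case: ifP.
  move=> zQ; have Hz := carleson_square_sub_upper (set_mem zQ).
  rewrite mem_set// mul1r -!EFinM; congr EFin.
  rewrite length_grid_interval powRM ?invr_ge0 ?exprz_ge0 ?(ltW Hz)//.
  by rewrite -powR_inv1 ?exprz_ge0// -powRrM mulN1r; ring.
rewrite -ge0_integral_sum// /intV -ge0_integralZl//; last 3 first.
- by apply: emeasurable_funM; apply/measurable_EFinP => //; exact: my.
- by move=> z Hz; rewrite mule_ge0 ?lee_fin ?powR_ge0 ?g0.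
- by rewrite lee_fin ltW.
apply: le_integral_ge0 => z Hz; first by apply: sume_ge0 => i _; exact: F0.
rewrite /F sumEFin -!EFinM lee_fin -mulr_suml.
by apply: ler_wpM2r; rewrite ?mulr_ge0 ?g0 ?powR_ge0//; exact: cP.
Qed.

(** * The testing condition on one square *)

(* The choice e = (a + 1) / (2 p' r') gives y^(- e p' r') dV_a the density
   y^((a - 1) / 2), still integrable at 0; A and Y are the masses of a square of
   side l for dV_a and for that measure. *)
Lemma square_constant (R : realType) (a p q p' r r' l : R) :
  -1 < a -> 0 < p -> p^-1 + (p' * r)^-1 + (p' * r')^-1 = 1 -> 0 < l ->
  let e := (a + 1) / 2 / (p' * r') in
  let A := l `^ (a + 2) / (a + 1) in
  let Y := l `^ (a - (a + 1) / 2 + 2) / (a - (a + 1) / 2 + 1) in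
  A `^ (q / p) * (A `^ (p' * r)^-1 * Y `^ (p' * r')^-1 / A) `^ q =
  2 `^ (q / (p' * r')) * (l `^ (- (e * p))) `^ (q / p).
Proof.
move=> a1 p0 pE l0 e A Y.
have a10 : 0 < a + 1 by lra.
have A0 : 0 < A by rewrite divr_gt0 ?powR_gt0.
have powRD0 (x s t : R) : 0 < x -> x `^ (s + t) = x `^ s * x `^ t.
  by move=> x0; rewrite powRD//; apply/implyP => _; rewrite gt_eqF.
(* The lowered exponent plus 1 is (a + 1) / 2, half of a + 1; this produces the factor 2. *)
have YE : Y = 2 * l `^ (- ((a + 1) / 2)) * A.
  rewrite /Y /A (_ : a - (a + 1) / 2 + 2 = - ((a + 1) / 2) + (a + 2)); last by ring.
  rewrite (powRD0 _ _ (a + 2))// (_ : a - (a + 1) / 2 + 1 = (a + 1) / 2); last by field.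
  by field; rewrite gt_eqF.
(* The exponents of A add up to 1/(p' r) + 1/(p' r') - 1 = -1/p, so its q-th power cancels
   A^(q/p). *)
have -> : A `^ (p' * r)^-1 * Y `^ (p' * r')^-1 / A =
    (2 * l `^ (- ((a + 1) / 2))) `^ (p' * r')^-1 * A `^ (- p^-1).
  have B0 : 0 <= 2 * l `^ (- ((a + 1) / 2)) by rewrite mulr_ge0 ?powR_ge0.
  rewrite YE (powRM _ B0 (ltW A0)) mulrCA -mulrA; congr (_ * _).
  rewrite -(powR_inv1 (ltW A0)) -!powRD0//; congr powR.
  by rewrite -pE; move: p^-1 (p' * r)^-1 (p' * r')^-1 => x y z; ring.
rewrite powRM ?powR_ge0// -(powRrM A) mulrCA -powRD0// mulNr [p^-1 * q]mulrC subrr.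
rewrite powRr0 mulr1 (powRM _ (ler0n R 2) (powR_ge0 _ _)).
rewrite (powRM q (powR_ge0 2 _) (powR_ge0 _ _)).
rewrite -(powRrM 2) -!(powRrM l).
congr (2 `^ _ * l `^ _); first by rewrite mulrC.
have aux (u v x : R) : v != 0 -> - (u * v) * (x / v) = - u * x by move=> v0; field.
by rewrite aux ?gt_eqF// /e mulNr mulNr.
Qed.

(** Raised to the power q, the bound of [intV_hoelder] contains the mean of w^(-p' r) to the power q
    / (p' r), exactly the factor that the testing condition trades against mu Q. [square_constant]
    evaluates what remains. *)
Lemma square_testing (R : realType) (a p q p' r r' C : R)
    (phi w : plane R -> R) (mu : {measure set (plane R) -> \bar R}) (I : set R) :
  -1 < a -> 0 < p -> 0 < q -> 0 < p' -> p^-1 + p'^-1 = 1 ->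
  0 < r -> 0 < r' -> r^-1 + r'^-1 = 1 -> 0 < C -> bounded_interval I ->
  let Q : set (plane R) := carleson_square I in
  let e := (a + 1) / 2 / (p' * r') in
  measurable_fun Q phi -> measurable_fun Q w ->
  (forall z, 0 <= phi z) -> (forall z, 0 <= w z) ->
  ((intV a Q (neg_power w (p' * r)) / carleson_area a I) `^ (q / (p' * r)) * mu Q
    <= C%:E * carleson_area a I `^ (q / p))%E ->
  (((carleson_area a I)^-1 * intV a Q (EFin \o phi)) `^ q * mu Q <=
   (C * 2 `^ (q / (p' * r')))%:E *
   ((length I `^ (- (e * p)))%:E *
    intV a Q (fun z => ((phi z * w z) `^ p * z.2 `^ (e * p))%:E)) `^ (q / p))%E.
Proof.
move=> a1 p0 q0 p'0 pp' r0 r'0 rr' C0 bI Q e mphi mw phi0 w0 hmu.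
have [itvI _ l0] := bI.
have p'r0 : 0 < p' * r by rewrite mulr_gt0.
have p'r'0 : 0 < p' * r' by rewrite mulr_gt0.
have a10 : 0 < a + 1 by lra.
have mQ : measurable Q by exact: measurable_carleson_square.
have areaE := carleson_areaE a1 bI.
rewrite areaE in hmu *; set A := _ / _ in hmu *.
have A0 : 0 < A by rewrite divr_gt0 ?powR_gt0.
set W := intV a Q (neg_power w _) in hmu.
set N := intV a Q (fun z => ((phi z * w z) `^ p * _)%:E).
set X := intV a Q (EFin \o phi).
have W0 : (0 <= W)%E.
  by apply: integral_ge0 => z _; rewrite mule_ge0 ?neg_power_ge0// lee_fin powR_ge0.
have N0 : (0 <= N)%E.
  by apply: integral_ge0 => z _; rewrite lee_fin !mulr_ge0 ?powR_ge0.
have X0 : (0 <= X)%E.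
  by apply: integral_ge0 => z _; rewrite mule_ge0 ?lee_fin ?powR_ge0/=.
have iA : A%:E^-1%E = A^-1%:E by rewrite inver gt_eqF.
rewrite iA in hmu *.
(* If W = +oo (e.g. if w vanishes on a set of positive area), the pointwise
   factorization of phi may fail, but the hypothesis forces mu Q = 0. *)
have [Wy|Wfin] := eqVneq W +oo%E.
  have -> : mu Q = 0%E.
    apply/eqP; rewrite eq_le measure_ge0 andbT leNgt; apply/negP => muQ.
    move: hmu; rewrite Wy gt0_mulye ?lte_fin ?invr_gt0// poweRyr; last first.
      by rewrite gt_eqF// divr_gt0.
    by rewrite gt0_mulye// -EFinM leye_eq.
  by rewrite mule0 mule_ge0 ?poweR_ge0// lee_fin mulr_ge0 ?powR_ge0 ?ltW.
have Wlt : (W < +oo)%E by rewrite ltey.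
have := @intV_hoelder R phi w a e p p' r r' Q p0 p'0 pp' r0 r'0 rr' mQ
  (@carleson_square_sub_upper R I) mphi mw (fun z _ => phi0 z) (fun z _ => w0 z) Wlt.
rewrite -/X -/N -/W.
have -> : a - e * p' * r' = a - (a + 1) / 2.
  by rewrite /e; field; rewrite !gt_eqF.
rewrite -/(carleson_area _ _) carleson_areaE//; last by lra.
set Y := _ / _ => hX.
have V0 : (0 <= W * A^-1%:E)%E by rewrite mule_ge0// lee_fin invr_ge0 ltW.
set V := (W * A^-1%:E)%E in hmu V0.
have WE : W = (V * A%:E)%E by rewrite /V -muleA -EFinM mulVf ?gt_eqF// mule1.
(* The constants collected: A^(1/(p' r)) from writing W as the mean V times A, the Y factor from
   Hoelder, and 1 / A from averaging phi. *)
pose k := A `^ (p' * r)^-1 * Y `^ (p' * r')^-1 / A.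
have k0 : 0 <= k by rewrite !mulr_ge0 ?powR_ge0// invr_ge0 ltW.
have hXA : (A^-1%:E * X <= N `^ p^-1 * (V `^ (p' * r)^-1 * k%:E))%E.
  apply: le_trans (lee_wpmul2l _ hX) _; first by rewrite lee_fin invr_ge0 ltW.
  rewrite WE poweRM ?lee_fin ?(ltW A0)// !poweR_EFin.
  rewrite muleCA -(muleA (V `^ _)%E) [(A^-1%:E * _)%E]muleCA -!EFinM.
  by rewrite /k [A^-1 * _]mulrC.
apply: (@le_trans _ _ ((N `^ p^-1 * (V `^ (p' * r)^-1 * k%:E)) `^ q * mu Q)%E).
  apply: lee_wpmul2r => //; apply: lee_poweR => //; first exact: ltW.
  by rewrite mule_ge0// lee_fin invr_ge0 ltW.
rewrite poweRM ?poweR_ge0 ?mule_ge0 ?poweR_ge0 ?lee_fin//.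
rewrite poweRM ?poweR_ge0 ?lee_fin// -!poweRrM poweR_EFin.
rewrite [(p' * r)^-1 * q]mulrC [p^-1 * q]mulrC.
have -> : ((C * 2 `^ (q / (p' * r')))%:E *
    ((length I `^ (- (e * p)))%:E * N) `^ (q / p) =
    N `^ (q / p) * ((C * A `^ (q / p))%:E * (k `^ q)%:E))%E.
  rewrite poweRM ?lee_fin ?powR_ge0// poweR_EFin muleA -EFinM -mulrA.
  rewrite -(@square_constant R a p q p' r r' _ a1 p0 _ l0); last first.
    by rewrite -pp' !invfM -addrA -mulrDr rr' mulr1.
  by rewrite -/A -/Y -/k mulrA EFinM muleC.
rewrite -muleA; apply: lee_wpmul2l; first exact: poweR_ge0.
rewrite muleAC; apply: lee_wpmul2r; first by rewrite lee_fin powR_ge0.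
by rewrite EFinM -poweR_EFin.
Qed.

(** * Domination of the maximal function by a sum over the grid *)

Definition grid_square (R : realType) (i : int * int) : set (R * R) :=
  carleson_square (@grid_interval R i.1 i.2).

Definition grid_average (R : realType) (a : R) (phi : R * R -> R) (i : int * int) : \bar R :=
  ((carleson_area a (@grid_interval R i.1 i.2))^-1 *
   intV a (@grid_square R i) (EFin \o phi))%E.

(* [pickle_inv] enumerates the pairs (k, m) without repetition. *)
Lemma maximal_le_grid (R : realType) (a q : R) (f : R * R -> R[i])
    (phi : plane R -> R) (z : R * R) :
  -1 < a -> 0 < q -> (forall z, 0 <= phi z) ->
  measurable_fun (@upper_half_plane R : set (plane R)) phi ->
  (forall I : set R, bounded_interval I ->
    intV a (carleson_square I) (fun t => (cabs (f t))%:E) =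
    intV a (carleson_square I) (EFin \o phi)) ->
  (maximal a f z `^ q <= ((4 `^ (a + 2)) `^ q)%:E *
    \sum_(n <oo) oapp (fun i : int * int =>
      (\1_(@grid_square R i) z)%:E * grid_average a phi i `^ q) 0 (pickle_inv n))%E.
Proof.
move=> a1 q0 phi0 mphi fphi.
have a10 : 0 < a + 1 by lra.
set S := (\sum_(n <oo) _)%E.
set M := (_ * S)%E.
have X0 (B : set (plane R)) : (0 <= intV a B (EFin \o phi))%E.
  by apply: integral_ge0 => t _; rewrite mule_ge0 ?lee_fin ?powR_ge0/=.
have T0 n : (0 <= oapp (fun i : int * int =>
      (\1_(@grid_square R i) z)%:E * grid_average a phi i `^ q) 0 (pickle_inv n))%E.
  by case: (pickle_inv n) => //= i; rewrite mule_ge0 ?poweR_ge0.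
have S0 : (0 <= S)%E by apply: nneseries_ge0 => n _ _; exact: T0.
have M0 : (0 <= M)%E by rewrite mule_ge0// lee_fin powR_ge0.
have qE (x : \bar R) : (0 <= x)%E -> ((x `^ q) `^ q^-1 = x)%E.
  by move=> x0; rewrite -poweRrM mulfV ?gt_eqF// poweRe1.
(* Bounding the supremum by the q-th root of M reduces the claim to one interval at a time. *)
have mxM : (maximal a f z <= M `^ q^-1)%E.
  apply: ge_ereal_sup => _ [I bI <-].
  rewrite fphi// indicE; have [zI|_] := boolP (z \in _); last first.
    by rewrite !mul0e poweR_ge0.
  have [k [m [IJ lIJ lJI]]] := grid_interval_cover bI.
  have bJ := bounded_grid_interval R k m.
  set J := grid_interval k m in IJ lIJ lJI bJ.
  have QIJ : carleson_square I `<=` carleson_square J.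
    by move=> t [It /andP[t0 tl]]; split; [exact: IJ|rewrite t0 (lt_le_trans tl)].
  have [itvI _ lI] := bI; have [itvJ _ lJ] := bJ.
  rewrite div1e.
  (* Masses scale like the length to the power a + 2, so |J| <= 4 |I| costs a factor 4^(a + 2). *)
  apply: (@le_trans _ _ ((4 `^ (a + 2))%:E *
      ((carleson_area a J)^-1 * intV a (carleson_square J) (EFin \o phi)))%E).
    rewrite muleA; apply: lee_pmul => //.
    - by rewrite inve_ge0 carleson_areaE// lee_fin divr_ge0 ?powR_ge0 ?ltW.
    - rewrite !carleson_areaE// !inver !gt_eqF ?divr_gt0 ?powR_gt0// -EFinM lee_fin.
      rewrite !invf_div ler_pdivrMr ?powR_gt0//.
      set x := length I `^ _; set y := length J `^ _; set k4 := 4 `^ _.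
      rewrite (_ : k4 * ((a + 1) / y) * x = (a + 1) * (k4 * x / y)); last by ring.
      rewrite ler_peMr ?(ltW a10)// ler_pdivlMr ?powR_gt0// mul1r /k4 /x /y.
      rewrite -(powRM _ (ler0n R 4) (ltW lI)).
      have a20 : 0 <= a + 2 by lra.
      apply: (ge0_ler_powR a20) => //; rewrite nnegrE ?mulr_ge0//; exact: ltW.
    - apply: ge0_subset_integral => //; try exact: measurable_carleson_square.
        apply: emeasurable_funM; apply/measurable_EFinP.
          exact: (measurable_funS (@measurable_upper_half_plane R)
            (@carleson_square_sub_upper R J) mphi).
        exact: measurable_powR_snd.
      by move=> t _; rewrite mule_ge0 ?lee_fin ?powR_ge0/=.
  rewrite -[leLHS]qE; last first.
    rewrite mule_ge0 ?lee_fin ?powR_ge0// mule_ge0//.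
    by rewrite inve_ge0 carleson_areaE// lee_fin divr_ge0 ?powR_ge0 ?ltW.
  apply: lee_poweR; rewrite ?poweR_ge0 ?invr_ge0 ?(ltW q0)//.
  rewrite poweRM ?lee_fin ?powR_ge0//; last first.
    rewrite mule_ge0// inve_ge0 carleson_areaE// lee_fin divr_ge0 ?powR_ge0//.
    exact: ltW.
  rewrite poweR_EFin; apply: lee_wpmul2l; first by rewrite lee_fin powR_ge0.
  (* The wanted term is the last one of this partial sum. *)
  apply: (@le_trans _ _ (\sum_(0 <= n < (pickle (k, m)).+1)
      oapp (fun i : int * int =>
      (\1_(@grid_square R i) z)%:E * grid_average a phi i `^ q) 0 (pickle_inv n))%E).
    rewrite big_nat_recr//= pickleK_inv/= indicE mem_set/=; last first.
      by apply: QIJ; exact: set_mem.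
    by rewrite mul1e leeDr// sume_ge0.
  exact: nneseries_lim_ge.
have mx0 : (0 <= maximal a f z)%E.
  have b01 := bounded_grid_interval R 0 0.
  apply: le_trans (ereal_sup_ubound _); last by exists (@grid_interval R 0 0).
  rewrite fphi// mule_ge0// mule_ge0 ?lee_fin// inve_ge0 carleson_areaE//.
  by rewrite lee_fin divr_ge0 ?powR_ge0 ?ltW.
apply: (@le_trans _ _ ((M `^ q^-1) `^ q)%E).
  by apply: lee_poweR => //; exact: ltW.
by rewrite -poweRrM mulVf ?gt_eqF// poweRe1.
Qed.

(** * The weighted inequality for the maximal function *)

Theorem corollary1p4 (R : realType) (alpha p q p' : R)
    (halpha : -1 < alpha) (hp : 1 < p) (hpq : p <= q)
    (hp' : p^-1 + p'^-1 = 1)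
    (w : R * R -> R) (hw : weight w)
    (mu : {measure set (plane R) -> \bar R})
    (r : R) (hr : 1 < r) (C : R) (hC : 0 < C)
    (hmu : forall I : set R, bounded_interval I ->
      ((intV alpha (carleson_square I) (neg_power w (p' * r))
          / carleson_area alpha I) `^ (q / (p' * r))
        * mu (carleson_square I)
       <= C%:E * carleson_area alpha I `^ (q / p))%E) :
  exists2 K : R, 0 < K & forall f : R * R -> R[i], LpV p alpha w f ->
    ((\int[mu]_(z in @upper_half_plane R) (maximal alpha f z `^ q)) `^ q^-1
     <= K%:E * normV p alpha (fun z => (f z * (w z)%:C%C)%R))%E.
Proof.
have p0 : 0 < p by lra.
have q0 : 0 < q by lra.
have a10 : 0 < alpha + 1 by lra.
have p'0 : 0 < p'.
  have : p^-1 < 1 by rewrite invf_lt1.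
  by rewrite -invr_gt0; lra.
have r0 : 0 < r by lra.
have rV : r^-1 < 1 by rewrite invf_lt1.
pose r' := (1 - r^-1)^-1.
have r'0 : 0 < r' by rewrite invr_gt0; lra.
have rr' : r^-1 + r'^-1 = 1 by rewrite /r' invrK; lra.
pose e := (alpha + 1) / 2 / (p' * r').
have e0 : 0 < e by apply: divr_gt0; [exact: divr_gt0|exact: mulr_gt0].
have ep0 : 0 < e * p by rewrite mulr_gt0.
have t1 : 1 <= q / p by rewrite ler_pdivlMr// mul1r.
set H := @upper_half_plane R.
have mH : measurable (H : set (plane R)) by exact: measurable_upper_half_plane.
case: hw => wm w0 _; have [v [mv v0 wv]] := Lebesgue_measurable_fun_ge0 wm w0.
have mQ (I : set R) : bounded_interval I ->
    measurable (carleson_square I : set (plane R)).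
  by case=> ? _ _; exact: measurable_carleson_square.
have QH (I : set R) := @carleson_square_sub_upper R I.
have my s (D : set (plane R)) := @measurable_powR_snd R s D.
(* The testing condition passes to the Borel representative v, as the two negative powers agree
   almost everywhere. *)
have {}hmu (I : set R) : bounded_interval I ->
    ((intV alpha (carleson_square I) (neg_power v (p' * r))
      / carleson_area alpha I) `^ (q / (p' * r)) * mu (carleson_square I)
     <= C%:E * carleson_area alpha I `^ (q / p))%E.
  move=> bI.
  have <- : intV alpha (carleson_square I) (neg_power w (p' * r)) =
    intV alpha (carleson_square I) (neg_power v (p' * r)).
    apply: (ae_eq_intV alpha (mQ I bI)).
    - apply: measurable_neg_power; first exact: mQ.
      exact: measurable_funS mH (QH I) mv.
    - by move=> z _; exact: neg_power_ge0.
    - by move=> z _; exact: neg_power_ge0.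
    apply: (@filterS _ _ (ae_filter_ringOfSetsType (area R)) _ _ _ wv).
    by move=> z + Qz => /(_ (QH I z Qz)); rewrite /neg_power => ->.
  exact: hmu.
have [c c0 emb] := grid_embedding alpha ep0.
pose D := C * 2 `^ (q / (p' * r')).
have D0 : 0 < D by rewrite mulr_gt0 ?powR_gt0.
(* The factors come from the grid cover, from the testing condition on a square, and from the grid
   overlap to the power q / p. *)
pose B := (4 `^ (alpha + 2)) `^ q * (D * c `^ (q / p)).
have B0 : 0 < B by rewrite !mulr_gt0 ?powR_gt0.
exists (B `^ q^-1); first by rewrite powR_gt0.
move=> f [mf _]; have [phi [mphi phi0 fphi]] := Lebesgue_measurable_cabs mf.
pose g (z : plane R) := (phi z * v z) `^ p.
have mg : measurable_fun (H : set (plane R)) g.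
  apply: (@measurableT_comp _ _ _ _ _ _ (@powR R ^~ p)).
    exact: measurable_powR.
  exact: measurable_funM.
have g0 z : H z -> 0 <= g z by rewrite powR_ge0.
have fwg : intV alpha H (fun z => (cabs (f z * (w z)%:C%C) `^ p)%:E) =
    intV alpha H (EFin \o g).
  apply: (ae_eq_intV alpha mH).
  - exact/measurable_EFinP.
  - by move=> z _; rewrite lee_fin powR_ge0.
  - by move=> z _; rewrite lee_fin powR_ge0.
  apply: (@filterS2 _ _ (ae_filter_ringOfSetsType (area R)) _ _ _ _ fphi wv).
  move=> z + + Hz => /(_ Hz) phiz /(_ Hz) vz.
  rewrite /g /= -phiz -vz /cabs ComplexField.Normc.normcM.
  by rewrite /= expr0n addr0 sqrtr_sqr ger0_norm ?w0.
rewrite /normV -/H fwg; set G := intV alpha H (EFin \o g).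
have fX (I : set R) : bounded_interval I ->
    intV alpha (carleson_square I) (fun t => (cabs (f t))%:E) =
    intV alpha (carleson_square I) (EFin \o phi).
  move=> bI; apply: (ae_eq_intV alpha (mQ I bI)).
  - by apply/measurable_EFinP; exact: measurable_funS mH (QH I) mphi.
  - by move=> z _; rewrite lee_fin /cabs; case: (f z) => u t; exact: sqrtr_ge0.
  - by move=> z _; rewrite lee_fin phi0.
  apply: (@filterS _ _ (ae_filter_ringOfSetsType (area R)) _ _ _ fphi).
  by move=> z + Qz => /(_ (QH I z Qz)) /= ->.
have G0 : (0 <= G)%E.
  by apply: integral_ge0 => z _; rewrite mule_ge0 ?lee_fin ?powR_ge0.
pose F i := (grid_average alpha phi i `^ q)%E.
have F0 i : (0 <= F i)%E by exact: poweR_ge0.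
have mQi i : measurable (@grid_square R i : set (plane R)).
  exact: mQ (bounded_grid_interval _ _ _).
(* The grid is enumerated by natural numbers; a number that encodes no pair contributes 0. *)
pose T n (z : plane R) := oapp (fun i : int * int =>
  (\1_(@grid_square R i) z)%:E * F i)%E 0%E (pickle_inv n).
have T0 n z : (0 <= T n z)%E.
  rewrite /T; case: (pickle_inv n) => [i|] /=; last exact: lexx.
  by apply: mule_ge0 (F0 i); rewrite lee_fin.
have mI i : measurable_fun (H : set (plane R)) (fun z => (\1_(@grid_square R i) z : R)%:E).
  by apply/measurable_EFinP; exact: measurable_indic.
have mT n : measurable_fun (H : set (plane R)) (T n).
  rewrite /T; case: (pickle_inv n) => [i|] /=; last exact: measurable_cst.
  by apply: emeasurable_funM (mI i) _; exact: measurable_cst.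
have intT n : (\int[mu]_(z in H) T n z =
    oapp (fun i => F i * mu (@grid_square R i)) 0 (pickle_inv n))%E.
  rewrite /T; case: (pickle_inv n) => [i|] /=; last exact: integral0.
  have I0 (z : plane R) : H z -> (0 <= (\1_(@grid_square R i) z : R)%:E)%E.
    by move=> _; rewrite lee_fin.
  under eq_integral do rewrite muleC.
  rewrite (ge0_integralZl mu mH (mI i) I0 (F0 i)) (integral_indic mu mH (mQi i)).
  congr (_ * mu _)%E; apply: setIidl; exact: QH.
have main : (\int[mu]_(z in H) (maximal alpha f z `^ q) <= (B%:E * G `^ (q / p)))%E.
  apply: (@le_trans _ _ (\int[mu]_(z in H) (((4 `^ (alpha + 2)) `^ q)%:E * \sum_(n <oo) T n z))%E).
    apply: le_integral_ge0 => z Hz; first exact: poweR_ge0.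
    exact: maximal_le_grid.
  have mS : measurable_fun (H : set (plane R)) (fun z => \sum_(n <oo) T n z)%E.
    by apply: ge0_emeasurable_sum => [n z _ _|n _]; [exact: T0|exact: mT].
  have S0 (z : plane R) : H z -> (0 <= \sum_(n <oo) T n z)%E.
    by move=> _; apply: nneseries_ge0 => n _ _; exact: T0.
  have k0 : (0 <= ((4 `^ (alpha + 2)) `^ q)%:E :> \bar R)%E.
    by rewrite lee_fin powR_ge0.
  rewrite (ge0_integralZl mu mH mS S0 k0).
  rewrite /B EFinM -muleA; apply: (lee_wpmul2l k0).
  rewrite (integral_nneseries mu mH mT (fun n z _ => T0 n z)).
  under eq_eseriesr do rewrite intT.
  (* It is enough to bound each partial sum, which runs over a finite list s of distinct grid
     squares. *)
  apply: lime_le.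
    apply: is_cvg_nneseries => n _ _.
    case: (pickle_inv n) => [i|] /=; last exact: lexx.
    exact: mule_ge0 (F0 i) (measure_ge0 mu _).
  apply: nearW => n /=; rewrite big_mkord.
  pose s := pmap (@pickle_inv (int * int)%type) (iota 0 n).
  have us : uniq s.
    apply: pmap_uniq; [exact: pickle_invK|exact: iota_uniq].
  rewrite (_ : (\sum_(i < n) _)%E = (\sum_(i <- s) F i * mu (@grid_square R i))%E); last first.
    by rewrite /s big_pmap -[in RHS](subn0 n) -/(index_iota 0 n) big_mkord.
  pose b (i : int * int) := ((length (@grid_interval R i.1 i.2) `^ (- (e * p)))%:E *
    intV alpha (@grid_square R i) (fun z => (g z * z.2 `^ (e * p))%:E))%E.
  have b0 i : (0 <= b i)%E.
    apply: mule_ge0; first by rewrite lee_fin powR_ge0.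
    apply: integral_ge0 => z _.
    by apply: mule_ge0; rewrite lee_fin ?mulr_ge0 ?powR_ge0.
  apply: (@le_trans _ _ (\sum_(i <- s) D%:E * b i `^ (q / p))%E).
    apply: lee_sum => i _; have bI := bounded_grid_interval R i.1 i.2.
    exact: (square_testing halpha p0 q0 p'0 hp' r0 r'0 rr' hC bI
      (measurable_funS mH (QH _) mphi) (measurable_funS mH (QH _) mv)
      phi0 v0 (hmu _ bI)).
  rewrite -ge0_sume_distrr; last by move=> i _; exact: poweR_ge0.
  rewrite (EFinM D) -muleA; apply: lee_wpmul2l; first by rewrite lee_fin ltW.
  apply: le_trans (sum_poweR_le s t1 b0) _.
  have cE0 : (0 <= c%:E)%E by rewrite lee_fin ltW.
  rewrite -poweR_EFin -(poweRM _ cE0 G0).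
  apply: lee_poweR; first by rewrite divr_ge0 ?ltW.
    by apply: sume_ge0.
  exact: emb.
apply: (@le_trans _ _ ((B%:E * G `^ (q / p)) `^ q^-1)%E).
  apply: lee_poweR main; first by rewrite invr_ge0 ltW.
  by apply: integral_ge0 => z _; exact: poweR_ge0.
have BE0 : (0 <= B%:E)%E by rewrite lee_fin ltW.
have qE : q / p * q^-1 = p^-1 by rewrite mulrAC mulfV ?mul1r ?gt_eqF.
by rewrite (poweRM _ BE0 (poweR_ge0 _ _)) -poweRrM qE.
Qed.
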